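(* Let $(N,J,h)$ be an almost anti-Hermitian manifold and let $\nabla$ be a linear connection on $N$ with torsion tensor $T^{\nabla}$. Assume that $(\nabla,h)$ is a quasi-statistical structure, i.e. $d^{\nabla}h=0$. Then $(N,J,h)$ is a quasi-Kähler-Norden manifold if and only if for all vector fields $X_1,X_2,X_3$ on $N$ $$h\big(X_2,(\nabla_{X_3}J)X_1\big)+h\big(X_3,(\nabla_{X_1}J)X_2\big)+h\big(X_1,(\nabla_{X_2}J)X_3\big)$$ $$=-\Big(h\big(X_2,T^{\nabla}(JX_1,X_3)\big)+h\big(X_3,T^{\nabla}(JX_2,X_1)\big)+h\big(X_1,T^{\nabla}(JX_3,X_2)\big)\Big).$$
   Context: An almost anti-Hermitian (Norden) manifold $(N,J,h)$ is a $2n$-dimensional smooth manifold $N$ with an almost complex structure $J$ ($J^2=-\mathrm{id}$) and a pseudo-Riemannian metric $h$ (necessarily of neutral signature $(n,n)$) such that $h(JX,Y)=h(X,JY)$ for all vector fields $X,Y$. It is called quasi-Kähler-Norden if $$h((\nabla^h_{X_1}J)X_2,X_3)+h((\nabla^h_{X_2}J)X_3,X_1)+h((\nabla^h_{X_3}J)X_1,X_2)=0$$ for all vector fields $X_1,X_2,X_3$, where $\nabla^h$ is the Levi-Civita connection of $h$. For a linear connection $\nabla$: $T^{\nabla}(X,Y)=\nabla_XY-\nabla_YX-[X,Y]$; $(\nabla_XJ)Y=\nabla_X(JY)-J\nabla_XY$; and $(d^{\nabla}h)(X,Y,Z)=(\nabla_Xh)(Y,Z)-(\nabla_Yh)(X,Z)+h(T^{\nabla}(X,Y),Z)$.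 *)

(* Defs.v *)
(* MathComp-Analysis; the real numbers are an arbitrary [R : realType]. *)
From HB Require Import structures.
From mathcomp Require Import all_boot all_order all_algebra.
From mathcomp Require Import boolp classical_sets functions cardinality reals.
From mathcomp Require Import topology normedtype derive ring.

Set Implicit Arguments.
Unset Strict Implicit.
Unset Printing Implicit Defensive.

Import Order.TTheory GRing.Theory Num.Theory.
Import numFieldNormedType.Exports.

Local Open Scope classical_set_scope.
Local Open Scope ring_scope.

Section Ck.
Variables (R : realType) (m : nat).
Implicit Types (U : set 'rV[R]_m) (f g : 'rV[R]_m -> R) (k : nat).

(* Meaningful for open [U]: values outside [U] then play no role. *)
Fixpoint Ck k U f : Prop :=
  (forall x, U x -> {for x, continuous f}) /\
  (if k is k'.+1 then
     forall i : 'I_m, (forall x, U x -> derivable f x (delta_mx 0 i)) /\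
                      Ck k' U ('D_(delta_mx 0 i) f)
   else True).

Definition smooth_on U f : Prop := forall k, Ck k U f.

Lemma CkW k U f : Ck k.+1 U f -> Ck k U f.
Proof.
elim: k f => [|k IH] f; first by move=> [].
by move=> [cf df]; split=> // i; have [d /IH] := df i.
Qed.

Lemma eq_Ck k U f g : open U -> (forall x, U x -> f x = g x) ->
  Ck k U f -> Ck k U g.
Proof.
move=> oU; elim: k f g => [|k IH] f g fg [cf df];
  have nfg x : U x -> \forall y \near x, f y = g y
    by move=> Ux; apply: filterS (open_nbhs_nbhs (conj oU Ux)) => y; exact: fg.
all: have cg x : U x -> {for x, continuous g}
  by move=> Ux; have fgx := fg x Ux; rewrite /prop_for /continuous_at -fgx;
     apply: cvg_trans (cf x Ux); exact: (@near_eq_cvg _ _ (nbhs x) _ _ _ (nfg x Ux)).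
all: split=> // i.
have [d1 d2] := df i; split.
  by move=> x Ux; apply: near_eq_derivable (d1 x Ux); exact: nfg.
by apply: IH d2 => x Ux; apply: near_eq_derive; exact: nfg.
Qed.

Lemma Ck_cst k U (a : R) : open U -> Ck k U (cst a).
Proof.
move=> oU; elim: k a => [|k IH] a; (split; first by move=> x _; exact: cst_continuous) => // i.
split=> [x _|]; first exact: derivable_cst.
by apply: (@eq_Ck _ _ (cst 0)) => // x Ux; rewrite derive_cst.
Qed.

Lemma CkD k U f g : open U -> Ck k U f -> Ck k U g -> Ck k U (f + g).
Proof.
move=> oU; elim: k f g => [|k IH] f g [cf df] [cg dg];
  (split; first by move=> x Ux; apply: continuousD; [exact: cf|exact: cg]) => // i.
have [f1 f2] := df i; have [g1 g2] := dg i; split=> [x Ux|].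
  by apply: derivableD; [exact: f1|exact: g1].
apply: (eq_Ck oU _ (IH _ _ f2 g2)) => x Ux.
by rewrite deriveD//; [exact: f1|exact: g1].
Qed.

Lemma CkM k U f g : open U -> Ck k U f -> Ck k U g -> Ck k U (f * g).
Proof.
move=> oU; elim: k f g => [|k IH] f g Cf Cg;
  have [cf df] := Cf; have [cg dg] := Cg;
  (split; first by move=> x Ux; apply: continuousM; [exact: cf|exact: cg]) => // i.
have [f1 f2] := df i; have [g1 g2] := dg i; split=> [x Ux|].
  by apply: derivableM; [exact: f1|exact: g1].
have H1 := IH _ _ (CkW Cf) g2; have H2 := IH _ _ (CkW Cg) f2.
apply: (eq_Ck oU _ (CkD oU H1 H2)) => x Ux.
by rewrite deriveM//; [exact: f1|exact: g1].
Qed.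

End Ck.

Section charts.
Variables (R : realType) (m : nat) (T : topologicalType).

Record chart := Chart {
  chart_dom : set T;
  chart_img : set 'rV[R]_m;
  chart_map : T -> 'rV[R]_m;
  chart_inv : 'rV[R]_m -> T;
  chart_dom_open : open chart_dom;
  chart_img_open : open chart_img;
  chart_mapP : forall p, chart_dom p -> chart_img (chart_map p);
  chart_invP : forall x, chart_img x -> chart_dom (chart_inv x);
  chart_mapK : forall p, chart_dom p -> chart_inv (chart_map p) = p;
  chart_invK : forall x, chart_img x -> chart_map (chart_inv x) = x;
  chart_map_continuous : forall p, chart_dom p -> {for p, continuous chart_map};
  chart_inv_continuous : forall x, chart_img x -> {for x, continuous chart_inv}
}.

Definition smooth_transition (c d : chart) : Prop :=
  forall j : 'I_m,
    smooth_on (chart_img c `&` chart_inv c @^-1` chart_dom d)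
              (fun x => chart_map d (chart_inv c x) 0 j).

End charts.

(* The atlas need not be maximal: the smooth structure is the one it generates. *)
Record smooth_manifold (R : realType) (m : nat) := SmoothManifold {
  mf_space :> topologicalType;
  mf_hausdorff : hausdorff_space mf_space;
  mf_second_countable : @second_countable mf_space;
  mf_atlas : set (chart R m mf_space);
  mf_atlas_cover : forall p, exists2 c, mf_atlas c & chart_dom c p;
  mf_atlas_compat :
    forall c d, mf_atlas c -> mf_atlas d -> smooth_transition c d
}.

Section smooth_functions.
Variables (R : realType) (m : nat) (N : smooth_manifold R m).

Definition is_smooth (f : N -> R) : Prop :=
  forall c, mf_atlas c -> smooth_on (chart_img c) (f \o chart_inv c).

Definition smoothfun_pred : {pred N -> R} := mem [set f | is_smooth f].

Record smoothfun := SmoothFun {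
  smoothfun_val :> N -> R;
  smoothfun_mem : smoothfun_val \in smoothfun_pred
}.

HB.instance Definition _ := [isSub for smoothfun_val].
HB.instance Definition _ := [Choice of smoothfun by <:].

Lemma smoothfunP (f : smoothfun) : is_smooth f.
Proof. by have := smoothfun_mem f; rewrite inE. Qed.

Definition mk_smoothfun (f : N -> R) (sf : is_smooth f) : smoothfun :=
  SmoothFun (mem_set sf).

Lemma is_smooth_cst (a : R) : is_smooth (cst a).
Proof. by move=> c _ k; apply: Ck_cst; exact: chart_img_open. Qed.

Lemma is_smoothD f g : is_smooth f -> is_smooth g -> is_smooth (f + g).
Proof.
by move=> sf sg c Ac k; apply: CkD (sf c Ac k) (sg c Ac k); exact: chart_img_open.
Qed.

Lemma is_smoothM f g : is_smooth f -> is_smooth g -> is_smooth (f * g).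
Proof.
by move=> sf sg c Ac k; apply: CkM (sf c Ac k) (sg c Ac k); exact: chart_img_open.
Qed.

Lemma is_smoothN f : is_smooth f -> is_smooth (- f).
Proof. by move=> sf; rewrite -mulN1r; exact: is_smoothM (is_smooth_cst (-1)) sf. Qed.

Lemma smoothfun_subring_closed : subring_closed smoothfun_pred.
Proof.
split=> [|f g|f g]; rewrite !inE/=.
- exact: is_smooth_cst.
- by move=> sf sg; apply: is_smoothD => //; exact: is_smoothN.
- exact: is_smoothM.
Qed.

HB.instance Definition _ :=
  GRing.SubChoice_isSubComPzRing.Build _ _ smoothfun smoothfun_subring_closed.

Lemma smoothfun_subsemimod_closed : GRing.subsemimod_closed smoothfun_pred.
Proof.
split; first split; rewrite ?inE/=; first exact: is_smooth_cst.
- by move=> f g; rewrite !inE/=; exact: is_smoothD.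
- by move=> a f; rewrite !inE/= => sf; exact: is_smoothM (is_smooth_cst a) sf.
Qed.

HB.instance Definition _ :=
  GRing.SubZmodule_isSubLmodule.Build _ _ _ smoothfun smoothfun_subsemimod_closed.

End smooth_functions.

Section tangent_space.
Variables (R : realType) (m : nat) (N : smooth_manifold R m) (p : N).

(* Tangent vectors are derivations of the algebra of global smooth functions;
   bump functions (hence [mf_hausdorff]) make them local, so that this tangent
   space has dimension [m]. *)
Definition derivation_at : {pred smoothfun N -> R} :=
  mem [set v | scalar v /\ forall f g : smoothfun N, v (f * g) = v f * g p + f p * v g].

Record tangent := Tangent {
  tangent_val :> smoothfun N -> R;
  tangent_mem : tangent_val \in derivation_at
}.

HB.instance Definition _ := [isSub for tangent_val].
HB.instance Definition _ := [Choice of tangent by <:].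

Lemma derivation_at_submod_closed : submod_closed derivation_at.
Proof.
split=> [|a u v]; rewrite !inE/=.
  by split=> [a f g|f g]; rewrite ?mulr0 ?mul0r ?addr0.
move=> [lu du] [lv dv]; split=> [b f g|f g].
  have E h : (a *: u + v) h = a * u h + v h by [].
  by rewrite !E lu lv /=; ring.
have E h : (a *: u + v) h = a * u h + v h by [].
by rewrite !E du dv; ring.
Qed.

HB.instance Definition _ :=
  GRing.isSubmodClosed.Build R (smoothfun N -> R) derivation_at
    derivation_at_submod_closed.
HB.instance Definition _ := [SubChoice_isSubLmodule of tangent by <:].

Lemma tangentP (v : tangent) :
  scalar v /\ forall f g : smoothfun N, v (f * g) = v f * g p + f p * v g.
Proof. by have := tangent_mem v; rewrite inE. Qed.

End tangent_space.

Section vector_fields.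
Variables (R : realType) (m : nat) (N : smooth_manifold R m).

Definition smooth_field (X : forall p : N, tangent p) : Prop :=
  forall f : smoothfun N, is_smooth (fun p => X p f).

Record vfield := VField {
  vfield_val :> forall p : N, tangent p;
  vfieldP : smooth_field vfield_val
}.

Lemma vfield_eq (X Y : vfield) : (forall p, X p = Y p) -> X = Y.
Proof.
case: X Y => [X sX] [Y sY] /= XY.
have {XY} E : X = Y by apply: functional_extensionality_dep.
by case: _ / E sY => sY; congr VField; exact: Prop_irrelevance.
Qed.

HB.instance Definition _ := gen_eqMixin vfield.
HB.instance Definition _ := gen_choiceMixin vfield.

Fact smooth_field0 : smooth_field (fun p => 0).
Proof. by move=> f; exact: is_smooth_cst. Qed.

Fact smooth_fieldN (X : vfield) : smooth_field (fun p => - X p).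
Proof. by move=> f; exact: is_smoothN (vfieldP X f). Qed.

Fact smooth_fieldD (X Y : vfield) : smooth_field (fun p => X p + Y p).
Proof. by move=> f; exact: is_smoothD (vfieldP X f) (vfieldP Y f). Qed.

Fact smooth_fieldZ (f : smoothfun N) (X : vfield) :
  smooth_field (fun p => f p *: X p).
Proof. by move=> g; exact: is_smoothM (smoothfunP f) (vfieldP X g). Qed.

Definition vfield0 := VField smooth_field0.
Definition vfieldN X := VField (smooth_fieldN X).
Definition vfieldD X Y := VField (smooth_fieldD X Y).
Definition vfieldZ f X := VField (smooth_fieldZ f X).

Fact vfieldDA : associative vfieldD.
Proof. by move=> X Y Z; apply: vfield_eq => p /=; rewrite addrA. Qed.
Fact vfieldDC : commutative vfieldD.
Proof. by move=> X Y; apply: vfield_eq => p /=; rewrite addrC. Qed.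
Fact vfield0D : left_id vfield0 vfieldD.
Proof. by move=> X; apply: vfield_eq => p /=; rewrite add0r. Qed.
Fact vfieldND : left_inverse vfield0 vfieldN vfieldD.
Proof. by move=> X; apply: vfield_eq => p /=; rewrite addNr. Qed.

HB.instance Definition _ :=
  GRing.isZmodule.Build vfield vfieldDA vfieldDC vfield0D vfieldND.

Fact vfieldZA f g X : vfieldZ f (vfieldZ g X) = vfieldZ (f * g) X.
Proof. by apply: vfield_eq => p /=; rewrite scalerA. Qed.
Fact vfield1Z : left_id 1 vfieldZ.
Proof. by move=> X; apply: vfield_eq => p /=; rewrite scale1r. Qed.
Fact vfieldZDr : right_distributive vfieldZ +%R.
Proof. by move=> f X Y; apply: vfield_eq => p /=; rewrite scalerDr. Qed.
Fact vfieldZDl X : {morph vfieldZ^~ X : f g / f + g}.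
Proof. by move=> f g; apply: vfield_eq => p /=; rewrite scalerDl. Qed.

HB.instance Definition _ :=
  GRing.Zmodule_isLmodule.Build (smoothfun N) vfield
    vfieldZA vfield1Z vfieldZDr vfieldZDl.

Definition vfield_app (X : vfield) (f : smoothfun N) : smoothfun N :=
  mk_smoothfun (vfieldP X f).

Definition lie_bracket_at (X Y : vfield) (p : N) (f : smoothfun N) : R :=
  X p (vfield_app Y f) - Y p (vfield_app X f).

Fact vfield_app_linear X a f g :
  vfield_app X (a *: f + g) = a *: vfield_app X f + vfield_app X g.
Proof. by apply/val_inj/funext => p; have [/= -> _] := tangentP (X p). Qed.

Fact vfield_app_leibniz X f g :
  vfield_app X (f * g) = vfield_app X f * g + f * vfield_app X g.
Proof. by apply/val_inj/funext => p; have [/= _ ->] := tangentP (X p). Qed.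

Fact tangent_add (p : N) (v : tangent p) f g : v (f + g) = v f + v g.
Proof. by have [+ _] := tangentP v; move=> /(_ 1 f g); rewrite scale1r mul1r. Qed.

Fact lie_bracket_derivation X Y p : lie_bracket_at X Y p \in derivation_at p.
Proof.
have [lX dX] := tangentP (X p); have [lY dY] := tangentP (Y p).
rewrite inE/=; split=> [a f g|f g]; rewrite /lie_bracket_at.
  by rewrite !vfield_app_linear lX lY /=; ring.
by rewrite !vfield_app_leibniz !tangent_add !dX !dY /=; ring.
Qed.

Fact lie_bracket_smooth X Y :
  smooth_field (fun p => Tangent (lie_bracket_derivation X Y p)).
Proof.
by move=> f; exact: is_smoothD (vfieldP X (vfield_app Y f))
                   (is_smoothN (vfieldP Y (vfield_app X f))).
Qed.

Definition lie_bracket X Y : vfield := VField (lie_bracket_smooth X Y).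

End vector_fields.

Section tensors.
Variables (R : realType) (m : nat) (N : smooth_manifold R m).

Record almost_complex := AlmostComplex {
  ac_at : forall p : N, {linear tangent p -> tangent p};
  ac_smooth : forall X : vfield N, smooth_field (fun p => ac_at p (X p));
  ac_sqr : forall (p : N) (v : tangent p), ac_at p (ac_at p v) = - v
}.

Definition ac_app (J : almost_complex) (X : vfield N) : vfield N :=
  VField (ac_smooth J X).
Coercion ac_app : almost_complex >-> Funclass.

(* No condition on the signature of a pseudo-Riemannian metric is imposed:
   anti-Hermitian metrics are automatically neutral, as [h (J u) (J u) = - h u u]. *)
Record metric := Metric {
  metric_at : forall p : N, tangent p -> tangent p -> R;
  metric_linear : forall (p : N) (v : tangent p), scalar (fun u => metric_at u v);
  metric_sym : forall (p : N) (u v : tangent p), metric_at u v = metric_at v u;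
  metric_nondegenerate : forall (p : N) (u : tangent p),
    (forall v, metric_at u v = 0) -> u = 0;
  metric_smooth : forall X Y : vfield N, is_smooth (fun p => metric_at (X p) (Y p))
}.

Definition metric_app (h : metric) (X Y : vfield N) : smoothfun N :=
  mk_smoothfun (metric_smooth h X Y).
Coercion metric_app : metric >-> Funclass.

(* Homogeneity in the second argument for real constants follows from
   [nabla_leibniz], as derivations kill constants. *)
Record connection := Connection {
  nabla :> vfield N -> vfield N -> vfield N;
  nabla_linearl : forall Y, linear (fun X => nabla X Y);
  nabla_additiver : forall X Y Z, nabla X (Y + Z) = nabla X Y + nabla X Z;
  nabla_leibniz : forall X (f : smoothfun N) Y,
    nabla X (f *: Y) = vfield_app X f *: Y + f *: nabla X Y
}.

Definition torsion (D : connection) (X Y : vfield N) : vfield N :=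
  D X Y - D Y X - lie_bracket X Y.

Definition cov_deriv_ac (D : connection) (J : almost_complex) (X Y : vfield N) :
    vfield N :=
  D X (J Y) - J (D X Y).

Definition cov_deriv_metric (D : connection) (h : metric) (X Y Z : vfield N) :
    smoothfun N :=
  vfield_app X (h Y Z) - h (D X Y) Z - h Y (D X Z).

Definition ext_deriv_metric (D : connection) (h : metric) (X Y Z : vfield N) :
    smoothfun N :=
  cov_deriv_metric D h X Y Z - cov_deriv_metric D h Y X Z + h (torsion D X Y) Z.

Definition quasi_statistical (D : connection) (h : metric) : Prop :=
  forall X Y Z, ext_deriv_metric D h X Y Z = 0.

Definition levi_civita (h : metric) (D : connection) : Prop :=
  (forall X Y, torsion D X Y = 0) /\
  (forall X Y Z, cov_deriv_metric D h X Y Z = 0).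

Definition almost_anti_hermitian (J : almost_complex) (h : metric) : Prop :=
  forall X Y, h (J X) Y = h X (J Y).

(* To be used with [Dh] the Levi-Civita connection of [h]. *)
Definition quasi_kahler_norden (J : almost_complex) (h : metric)
    (Dh : connection) : Prop :=
  forall X1 X2 X3,
    h (cov_deriv_ac Dh J X1 X2) X3 + h (cov_deriv_ac Dh J X2 X3) X1
    + h (cov_deriv_ac Dh J X3 X1) X2 = 0.

End tensors.

(* Main.v *)
(** For a quasi-statistical pair [(D, h)], the quantity
    [h (X, D_Y Z) - h (Y, D_X Z)] is determined by [h] and the Lie bracket
    alone. Since [J] is [h]-symmetric, the sum of the left-hand side and of the
    torsion terms is a cyclic sum of such quantities (with [X = X2], [Y = J X1],
    [Z = X3]) and of brackets, so it is the same for any two quasi-statistical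
    connections. The Levi-Civita connection is one of them, and for it that sum
    is the quasi-Kaehler-Norden expression. *)
Require Import Defs.
From mathcomp Require Import all_boot all_algebra reals.
From mathcomp Require Import boolp lra.

Import GRing.Theory.

Local Open Scope ring_scope.

Section quasi_statistical_theory.
Context {R : realType} {m : nat} {N : smooth_manifold R m}.
Implicit Types (h : metric N) (D : connection N) (J : almost_complex N).
Implicit Types (X Y Z : vfield N).

(** Evaluating at a point turns identities between smooth functions into real ones, where [lra]
    applies. *)
Lemma smoothfunDE (f g : smoothfun N) p : (f + g) p = f p + g p.
Proof. by []. Qed.

Lemma smoothfunNE (f : smoothfun N) p : (- f) p = - f p.
Proof. by []. Qed.

Lemma smoothfun_eq (f g : smoothfun N) : (forall p, f p = g p) -> f = g.
Proof. by move=> fg; apply/val_inj/funext. Qed.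

Lemma metricC h X Y : h X Y = h Y X.
Proof. by apply: smoothfun_eq => p; exact: metric_sym. Qed.

Lemma metricBl h X Y Z : h (X - Y) Z = h X Z - h Y Z.
Proof.
(* [metric_linear] expects the shape [a *: u + v]; here [a] is -1. *)
apply: smoothfun_eq => p /=; rewrite addrC -scaleN1r metric_linear.
by rewrite mulN1r addrC.
Qed.

Lemma metricBr h X Y Z : h X (Y - Z) = h X Y - h X Z.
Proof. by rewrite metricC metricBl !(metricC h X). Qed.

Lemma metric0r h X : h X 0 = 0.
Proof. by rewrite -(subrr 0) metricBr subrr. Qed.

Lemma levi_civita_quasi_statistical h D :
  levi_civita h D -> quasi_statistical D h.
Proof.
move=> [tors0 nablah0] X Y Z.
by rewrite /ext_deriv_metric !nablah0 tors0 metricC metric0r subrr addr0.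
Qed.

(** The terms in [D X Y] and [D Y X] cancel against the torsion, which leaves only its bracket. *)
Lemma quasi_statistical_swap h D X Y Z p : quasi_statistical D h ->
  h X (D Y Z) p - h Y (D X Z) p
  = vfield_app Y (h X Z) p - vfield_app X (h Y Z) p + h (lie_bracket X Y) Z p.
Proof.
move=> /(_ X Y Z) /(congr1 (fun f : smoothfun N => f p)).
rewrite /ext_deriv_metric /cov_deriv_metric /torsion !metricBl.
rewrite !(smoothfunDE, smoothfunNE) -[smoothfun_val 0 p]/0; lra.
Qed.

(** Difference of the two sides of the identity to be characterised. *)
Definition cyclic_defect h D J X1 X2 X3 : smoothfun N :=
  h X2 (cov_deriv_ac D J X3 X1) + h X3 (cov_deriv_ac D J X1 X2)
    + h X1 (cov_deriv_ac D J X2 X3)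
  + (h X2 (torsion D (J X1) X3) + h X3 (torsion D (J X2) X1)
     + h X1 (torsion D (J X3) X2)).

Lemma cyclic_defect_eq h D D' J X1 X2 X3 : almost_anti_hermitian J h ->
  quasi_statistical D h -> quasi_statistical D' h ->
  cyclic_defect h D J X1 X2 X3 = cyclic_defect h D' J X1 X2 X3.
Proof.
move=> hJ hD hD'; apply: smoothfun_eq => p.
have swap X Y Z : h X (D Y Z) p - h Y (D X Z) p = h X (D' Y Z) p - h Y (D' X Z) p.
  by rewrite !quasi_statistical_swap.
have := swap X2 (J X1) X3; have := swap X3 (J X2) X1; have := swap X1 (J X3) X2.
(* [h X2 (D X3 (J X1))] cancels between the derivative of [J] and the torsion. Moving [J] across [h]
   then pairs [h X2 (D (J X1) X3)] with [h (J X1) (D X2 X3)], which comes from another cyclic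
   summand. *)
rewrite /cyclic_defect /cov_deriv_ac /torsion !metricBr -!hJ.
rewrite !(smoothfunDE, smoothfunNE); lra.
Qed.

Lemma cyclic_defect_levi_civita h D J X1 X2 X3 : levi_civita h D ->
  cyclic_defect h D J X1 X2 X3
  = h (cov_deriv_ac D J X1 X2) X3 + h (cov_deriv_ac D J X2 X3) X1
    + h (cov_deriv_ac D J X3 X1) X2.
Proof.
move=> [tors0 _]; rewrite /cyclic_defect !tors0 !metric0r !addr0.
by rewrite -addrA addrC !(metricC h _ (cov_deriv_ac _ _ _ _)).
Qed.

End quasi_statistical_theory.

Theorem theorem5 (R : realType) (n : nat) (N : smooth_manifold R (2 * n)%N)
    (J : almost_complex N) (h : metric N) (Dh D : connection N)
    (hJ : almost_anti_hermitian J h)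
    (hDh : levi_civita h Dh)
    (hD : quasi_statistical D h) :
  quasi_kahler_norden J h Dh <->
  forall X1 X2 X3 : vfield N,
    h X2 (cov_deriv_ac D J X3 X1) + h X3 (cov_deriv_ac D J X1 X2)
      + h X1 (cov_deriv_ac D J X2 X3)
    = - (h X2 (torsion D (J X1) X3) + h X3 (torsion D (J X2) X1)
         + h X1 (torsion D (J X3) X2)).
Proof.
have E X1 X2 X3 : cyclic_defect h D J X1 X2 X3
    = h (cov_deriv_ac Dh J X1 X2) X3 + h (cov_deriv_ac Dh J X2 X3) X1
      + h (cov_deriv_ac Dh J X3 X1) X2.
  rewrite -cyclic_defect_levi_civita //.
  by apply: cyclic_defect_eq => //; exact: levi_civita_quasi_statistical.
split=> H X1 X2 X3.
  by apply/eqP; rewrite -addr_eq0; apply/eqP; rewrite -[LHS]/(cyclic_defect _ _ _ _ _ _) E.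
by rewrite -E /cyclic_defect H addNr.
Qed.
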